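(* Let $\mathbf{x}_c\in\mathbb{S}^{n-1}=\{\mathbf{x}\in\mathbb{R}^n:\mathbf{x}^\top\mathbf{x}=1\}$, $\mathbf{p}_c\in\mathbb{R}^n$ and $\alpha\in\mathbb{R}$. Put $W=\alpha(\mathbf{x}_c\mathbf{p}_c^\top-\mathbf{p}_c\mathbf{x}_c^\top)\in\mathbb{R}^{n\times n}$, $Q=(I-W)(I+W)^{-1}$ and $\mathbf{x}_{c+1}(\alpha)=Q\mathbf{x}_c$. Then $$\mathbf{x}_{c+1}(\alpha)=\frac{[(1-\alpha\mathbf{x}_c^\top\mathbf{p}_c)^2-\|\alpha\mathbf{p}_c\|^2]\mathbf{x}_c+2\alpha\mathbf{p}_c}{1+\|\alpha\mathbf{p}_c\|^2-(\alpha\mathbf{x}_c^\top\mathbf{p}_c)^2}$$ and $$\|\mathbf{x}_{c+1}(\alpha)-\mathbf{x}_c\|=2\left(\frac{\|\alpha\mathbf{p}_c\|^2-(\alpha\mathbf{x}_c^\top\mathbf{p}_c)^2}{1+\|\alpha\mathbf{p}_c\|^2-(\alpha\mathbf{x}_c^\top\mathbf{p}_c)^2}\right)^{1/2}.$$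
   Context: $\|\cdot\|$ is the Euclidean norm and $I$ the $n\times n$ identity matrix. Since $W$ is skew-symmetric, $I+W$ is invertible. *)

(* Defs.v *)
(* MathComp matrices over an arbitrary model [R : realType] of the real numbers. *)
From mathcomp Require Import all_boot all_order all_algebra.
From mathcomp Require Import reals.

Set Implicit Arguments.
Unset Strict Implicit.
Unset Printing Implicit Defensive.

Import Order.TTheory GRing.Theory Num.Theory.
Local Open Scope ring_scope.

Definition dotp (R : realType) (n : nat) (u v : 'cV[R]_n) : R :=
  (u^T *m v) 0 0.

(* The norm MathComp-Analysis puts on matrices is the sup norm, not this one. *)
Definition enorm (R : realType) (n : nat) (u : 'cV[R]_n) : R :=
  Num.sqrt (\sum_(i < n) u i 0 ^+ 2).

Definition Wmx (R : realType) (n : nat) (x p : 'cV[R]_n) (alpha : R) : 'M[R]_n :=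
  alpha *: (x *m p^T - p *m x^T).

(* [invmx] is total, with junk value [invmx A = A] for singular [A];
   by [unitmx_1_add_Wmx] below it is the true inverse when [W = Wmx x p alpha]. *)
Definition cayley (R : realType) (n : nat) (W : 'M[R]_n) : 'M[R]_n :=
  (1%:M - W) *m invmx (1%:M + W).

Definition xnext (R : realType) (n : nat) (x p : 'cV[R]_n) (alpha : R) : 'cV[R]_n :=
  cayley (Wmx x p alpha) *m x.

Lemma Wmx_skew (R : realType) (n : nat) (x p : 'cV[R]_n) (alpha : R) :
  (Wmx x p alpha)^T = - Wmx x p alpha.
Proof.
by rewrite /Wmx linearZ linearB /= !trmx_mul !trmxK -scalerN opprB.
Qed.

Lemma unitmx_1_add_skew (R : realType) (n : nat) (W : 'M[R]_n) :
  W^T = - W -> 1%:M + W \in unitmx.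
Proof.
move=> skW; rewrite -row_free_unit; apply/inj_row_free => v.
rewrite mulmxDr mulmx1 => /eqP; rewrite addr_eq0 => /eqP vW.
have vWv : v *m W *m v^T = 0.
  have E : (v *m W *m v^T)^T = - (v *m W *m v^T).
    by rewrite !trmx_mul trmxK skW mulNmx mulmxN mulmxA.
  move: (v *m W *m v^T) E => A /matrixP/(_ 0 0); rewrite !mxE => /eqP.
  rewrite -addr_eq0 -mulr2n mulrn_eq0 /= => /eqP A0.
  by apply/matrixP => i j; rewrite !ord1 A0 mxE.
have /matrixP/(_ 0 0) : v *m v^T = 0 by rewrite {1}vW mulNmx vWv oppr0.
rewrite !mxE => /eqP; rewrite psumr_eq0; last first.
  by move=> i _; rewrite mxE -expr2 sqr_ge0.
move=> /allP v0; apply/rowP => i; rewrite mxE.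
by have := v0 i (mem_index_enum i); rewrite mxE /= mulf_eq0 orbb => /eqP.
Qed.

Lemma unitmx_1_add_Wmx (R : realType) (n : nat) (x p : 'cV[R]_n) (alpha : R) :
  1%:M + Wmx x p alpha \in unitmx.
Proof. exact/unitmx_1_add_skew/Wmx_skew. Qed.

(* Main.v *)
(** Put [q = alpha p], [b = x^T q], [c = q^T q].  The matrix [W = x q^T - q x^T]
    preserves the span of [x] and [q], with [W x = b x - q] and [W q = c x - b q],
    so the equation [(I + W) y = x] has the solution
    [y = ((1 - b) x + q) / (1 + c - b^2)], and the new iterate is
    [(I - W) y = 2 y - x].  The denominator is positive because
    [c - b^2 = |q - b x|^2]. *)
Require Import Defs.
From mathcomp Require Import all_boot all_order all_algebra.
From mathcomp Require Import reals ring lra.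
Import Order.TTheory GRing.Theory Num.Theory.
Local Open Scope ring_scope.

Section DotProduct.
#[local] Set Implicit Arguments.
#[local] Unset Strict Implicit.
Variables (R : realType) (n : nat).
Implicit Types u v w : 'cV[R]_n.

Lemma dotpC u v : dotp u v = dotp v u.
Proof. by rewrite /dotp !mxE; apply: eq_bigr => i _; rewrite !mxE mulrC. Qed.

Lemma dotpDl u v w : dotp (u + v) w = dotp u w + dotp v w.
Proof. by rewrite /dotp linearD mulmxDl mxE. Qed.

Lemma dotpZl a u v : dotp (a *: u) v = a * dotp u v.
Proof. by rewrite /dotp linearZ -scalemxAl mxE. Qed.

Lemma dotpDr u v w : dotp u (v + w) = dotp u v + dotp u w.
Proof. by rewrite dotpC dotpDl !(dotpC u). Qed.

Lemma dotpZr a u v : dotp u (a *: v) = a * dotp u v.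
Proof. by rewrite dotpC dotpZl dotpC. Qed.

Lemma dotp_sum_sqr u : dotp u u = \sum_(i < n) u i 0 ^+ 2.
Proof. by rewrite /dotp mxE; apply: eq_bigr => i _; rewrite mxE expr2. Qed.

Lemma dotp_ge0 u : 0 <= dotp u u.
Proof. by rewrite dotp_sum_sqr sumr_ge0 // => i _; rewrite sqr_ge0. Qed.

Lemma enormE u : enorm u = Num.sqrt (dotp u u).
Proof. by rewrite /enorm dotp_sum_sqr. Qed.

Lemma sqr_enorm u : enorm u ^+ 2 = dotp u u.
Proof. by rewrite enormE sqr_sqrtr ?dotp_ge0. Qed.

(** Cauchy-Schwarz for a unit vector, from [0 <= |v - (u^T v) u|^2 = v^T v - (u^T v)^2]. *)
Lemma sqr_dotp_le u v : dotp u u = 1 -> dotp u v ^+ 2 <= dotp v v.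
Proof.
move=> u1; have := dotp_ge0 (v + (- dotp u v) *: u).
rewrite !(dotpDl, dotpDr, dotpZl, dotpZr) u1 (dotpC v u); nra.
Qed.

Lemma mulmx_dotp u v w : u *m v^T *m w = dotp v w *: u.
Proof. by rewrite -mulmxA [v^T *m w]mx11_scalar mul_mx_scalar. Qed.

Lemma Wmx_mul u v a w :
  Wmx u v a *m w = dotp (a *: v) w *: u - dotp u w *: (a *: v).
Proof.
rewrite /Wmx -scalemxAl mulmxBl !mulmx_dotp scalerBr dotpZl !scalerA.
by rewrite [a * dotp u w]mulrC.
Qed.

(** Since [(I - W) v = 2 v - (I + W) v], solving one linear system replaces computing the
    inverse. *)
Lemma cayley_mul (W : 'M[R]_n) u v : 1%:M + W \in unitmx ->
  (1%:M + W) *m v = u -> cayley W *m u = 2 *: v - u.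
Proof.
move=> unitW <-; rewrite /cayley -mulmxA mulKmx // mulmxBl mulmxDl mul1mx.
by rewrite scaler_nat mulr2n opprD addrA addrK.
Qed.

End DotProduct.

Theorem lemma4p2 (R : realType) (n : nat) (xc pc : 'cV[R]_n) (alpha : R)
    (hxc : dotp xc xc = 1) :
  xnext xc pc alpha =
    (1 + enorm (alpha *: pc) ^+ 2 - (alpha * dotp xc pc) ^+ 2)^-1 *:
      (((1 - alpha * dotp xc pc) ^+ 2 - enorm (alpha *: pc) ^+ 2) *: xc
       + (2 * alpha) *: pc)
  /\
  enorm (xnext xc pc alpha - xc) =
    2 * Num.sqrt ((enorm (alpha *: pc) ^+ 2 - (alpha * dotp xc pc) ^+ 2) /
                  (1 + enorm (alpha *: pc) ^+ 2 - (alpha * dotp xc pc) ^+ 2)).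
Proof.
rewrite sqr_enorm -!dotpZr -scalerA /xnext.
have := Wmx_mul xc pc alpha; have := unitmx_1_add_Wmx xc pc alpha.
(* From here on, only the invertibility of [I + W] and the action of [W] on vectors matter, and
   [alpha] survives only inside [q]. *)
move: (Wmx _ _ _) => W unitW; move: (alpha *: pc) => q Wmul.
have := sqr_dotp_le q hxc.
set b := dotp xc q; set c := dotp q q => le_bc.
have D_gt0 : 0 < 1 + c - b ^+ 2 by lra.
set D := 1 + c - b ^+ 2 in D_gt0 *.
have D_neq0 : D != 0 by rewrite gt_eqF.
have Wy : (1%:M + W) *m (D^-1 *: ((1 - b) *: xc + q)) = xc.
  rewrite -scalemxAr mulmxDl mul1mx Wmul.
  rewrite !(dotpDr, dotpZr) hxc (dotpC q xc) -/b -/c.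
  by apply/colP => i; rewrite !mxE /D; field.
have xnextE : cayley W *m xc = D^-1 *: (((1 - b) ^+ 2 - c) *: xc + 2 *: q).
  rewrite (cayley_mul unitW Wy).
  (* The coefficient of [xc] rests on [2 (1 - b) - D = (1 - b)^2 - c]. *)
  by apply/colP => i; rewrite !mxE /D; field.
split=> //; rewrite xnextE.
(* The difference is [2 (y - xc)], and [(1 - b) - D = b^2 - c - b]. *)
have -> : D^-1 *: (((1 - b) ^+ 2 - c) *: xc + 2 *: q) - xc
    = (2 / D) *: ((b ^+ 2 - c - b) *: xc + q).
  by apply/colP => i; rewrite !mxE /D; field.
(* With [s = c - b^2], the vector [q - (s + b) xc] has squared norm [s^2 + s = s D], so one factor
   [D] cancels against [(2 / D)^2]. *)
rewrite enormE !(dotpDl, dotpDr, dotpZl, dotpZr) hxc (dotpC q xc) -/b -/c.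
(* The outer factor 2 enters the root as [2^2], leaving an identity of radicands. *)
rewrite -[2 in RHS]ger0_norm // -sqrtr_sqr -sqrtrM ?sqr_ge0 //.
by congr Num.sqrt; rewrite /D; field.
Qed.
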